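(* Let $\psi$ be the Laplace exponent of a spectrally negative Lévy process without monotone paths, killed at rate $\kappa\ge 0$, and let $\theta=\sup\{\lambda\ge 0:\psi(\lambda)=0\}$. Let $x,\beta\geq 0$. Then $$W_{\mathcal{T}_{\beta}\psi}(x)=e^{-\beta x}W_{\psi}(x)+\beta\int_0^{x}e^{-\beta y}W_{\psi}(y)\,dy.$$ Moreover, if $\psi'(0+)\leq 0$, then for any $x,\delta\geq 0$, $$W_{\mathcal{T}_{\delta,\theta}\psi}(x)=e^{-\theta x}\left(W_{\psi}(x)+\delta e^{\delta x}\int_0^{x}e^{-\delta y}W_{\psi}(y)\,dy\right).$$
   Context: A (possibly killed) spectrally negative Lévy process $\xi$, killed at independent rate $\kappa\ge0$ (no killing if $\kappa=0$), has Laplace exponent $\psi$ with $\mathbb{E}(e^{u\xi_t})=e^{\psi(u)t}$ for $u,t\ge0$; in particular $\psi(0)=-\kappa$. Throughout $\xi$ does not have monotone paths. For $\delta,\beta\ge 0$, with $\psi'(0+)=\psi(0)=0$ required if $\beta=0$, define $$\mathcal{T}_{\delta,\beta}\psi(u)=\frac{u+\beta-\delta}{u+\beta}\,\psi(u+\beta)-\frac{\beta-\delta}{\beta}\,\psi(\beta),\quad u\ge-\beta,$$ where for $\beta=0$ the last term is interpreted as its limit $0$, so that $\mathcal{T}_{\delta,0}\psi(u)=\frac{u-\delta}{u}\psi(u)$. Write $\mathcal{T}_\beta=\mathcal{T}_{\beta,\beta}$, i.e. $\mathcal{T}_\beta\psi(u)=\frac{u}{u+\beta}\psi(u+\beta)$.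 These are again Laplace exponents of spectrally negative Lévy processes. The scale function $W_\psi:[0,\infty)\to[0,\infty)$ of a spectrally negative Lévy process with Laplace exponent $\psi$ is the unique continuous positive increasing function characterized by $$\int_0^\infty e^{-ux}W_\psi(x)\,dx=\frac1{\psi(u)},\qquad u>\sup\{\lambda\ge0:\psi(\lambda)=0\}.$$ *)

(* Defs.v *)
From HB Require Import structures.
From mathcomp Require Import all_boot all_order all_algebra.
From mathcomp Require Import all_classical all_reals all_analysis.
From mathcomp Require Import measurable_realfun.

Set Implicit Arguments.
Unset Strict Implicit.
Unset Printing Implicit Defensive.

Import Order.TTheory GRing.Theory Num.Theory.
Import numFieldNormedType.Exports.

Local Open Scope classical_set_scope.
Local Open Scope ring_scope.

Section Process.
Context {R : realType} {d : measure_display} {T : measurableType d}.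
Variable P : probability T R.

(* A process is a map X : R -> T -> R of which only the times t >= 0 matter. *)

Definition sigma_process (X : R -> T -> R) (D : set R) : set (set T) :=
  <<s [set A | exists2 t, D t &
         exists2 B : set R, measurable B & A = X t @^-1` B] >>.

Record levy_process (X : R -> T -> R) : Prop := LevyProcess {
  levy_measurable : forall t : R, 0 <= t -> measurable_fun setT (X t) ;
  levy_start : {ae P, forall w, X 0 w = 0} ;
  levy_independent : forall s t : R, 0 <= s -> s <= t ->
    forall (A : set T) (B : set R),
      sigma_process X `[0, s] A -> measurable B ->
      (P (A `&` [set w | B (X t w - X s w)%R]) =
       P A * P [set w | B (X t w - X s w)%R])%E ;
  levy_stationary : forall s t : R, 0 <= s -> 0 <= t ->
    forall B : set R, measurable B ->
      P [set w | B (X (s + t) w - X s w)] = P [set w | B (X t w)] ;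
  levy_rcont : {ae P, forall w, forall t : R, 0 <= t -> X^~ w @ t^'+ --> X t w} ;
  levy_llim : {ae P, forall w, forall t : R, 0 < t -> cvg (X^~ w @ t^'-)} }.

Definition no_positive_jumps (X : R -> T -> R) : Prop :=
  {ae P, forall w, forall t : R, 0 < t -> X t w <= lim (X^~ w @ t^'-)}.

Definition monotone_paths (X : R -> T -> R) : Prop :=
  {ae P, forall w, {in `[0, +oo[ &, {homo X^~ w : s t / s <= t}}} \/
  {ae P, forall w, {in `[0, +oo[ &, {homo X^~ w : s t /~ s <= t}}}.

(* For kappa = 0 this says that zeta = +oo almost surely. *)
Definition independent_killing_time (X : R -> T -> R) (kappa : R)
    (zeta : T -> \bar R) : Prop :=
  [/\ measurable_fun setT zeta,
      forall t : R, 0 <= t ->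
        P [set w | (t%:E < zeta w)%E] = (expR (- kappa * t))%:E &
      forall (A : set T) (B : set (\bar R)),
        sigma_process X `[0, +oo[ A -> measurable B ->
        (P (A `&` zeta @^-1` B) = P A * P (zeta @^-1` B))%E].

(* The killed process is X before time zeta and sits in a cemetery state from
   zeta on; the cemetery contributes 0 to every expectation, including u = 0,
   which forces psi 0 = - kappa. Values of psi on ]-oo, 0[ are irrelevant. *)
Definition is_laplace_exponent (X : R -> T -> R) (zeta : T -> \bar R)
    (psi : R -> R) : Prop :=
  forall u t : R, 0 <= u -> 0 <= t ->
    (\int[P]_(w in [set w | (t%:E < zeta w)%E]) (expR (u * X t w))%:E =
     (expR (psi u * t))%:E)%E.

End Process.

Section ScaleFunctions.
Context {R : realType}.
Implicit Types (psi W : R -> R) (delta beta : R).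

Definition largest_zero psi : R := sup [set l | 0 <= l /\ psi l = 0].

(* psi'(0+), which may be -oo. *)
Definition right_derivative0 psi : \bar R :=
  lim ((h^-1 * (psi h - psi 0))%:E @[h --> 0^'+]).

(* Both singular expressions (u + beta = 0 in the first term and beta = 0 in
   the second one) are read as limits; for beta = 0 the limit of the second
   term is 0 because psi(0) = psi'(0+) = 0 is then required. *)
Definition exponent_transform delta beta psi (u : R) : R :=
  (if u + beta == 0 then lim ((v - delta) / v * psi v @[v --> 0^'+])
   else (u + beta - delta) / (u + beta) * psi (u + beta))
  - (if beta == 0 then 0 else (beta - delta) / beta * psi beta).

Definition exponent_transform1 beta psi : R -> R :=
  exponent_transform beta beta psi.

(* W_psi is encoded as a predicate: W is a function on R of which only the
   restriction to [0, +oo[ matters. "Increasing" is taken in the weak sense,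
   the least demanding one. *)
Definition is_scale_function psi W : Prop :=
  [/\ {within `[0, +oo[, continuous W},
      forall x : R, 0 <= x -> 0 <= W x,
      forall x : R, 0 < x -> 0 < W x,
      {in `[0, +oo[ &, {homo W : x y / x <= y}} &
      forall u, largest_zero psi < u ->
        (\int[lebesgue_measure]_(x in `[0%R, +oo[) (expR (- u * x) * W x)%:E =
         ((psi u)^-1)%:E)%E].

End ScaleFunctions.

(* Main.v *)
Require Import Defs.
From HB Require Import structures.
From mathcomp Require Import all_boot all_order all_algebra.
From mathcomp Require Import all_classical all_reals all_analysis.
From mathcomp Require Import measurable_realfun.
From mathcomp Require Import ring lra.

Set Implicit Arguments.
Unset Strict Implicit.
Unset Printing Implicit Defensive.

Import Order.TTheory GRing.Theory Num.Theory.
Import numFieldNormedType.Exports.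

Local Open Scope classical_set_scope.
Local Open Scope ring_scope.

(** Both formulas come from one computation of Laplace transforms. Write
      F x = e^(- b x) (W x + d e^(d x) int_0^x e^(- d y) W y dy).
    The first formula is the case b = d = beta, because then
    e^(- b x) e^(d x) = 1, and the second one is the case b = theta, d = delta.
    The summand with the integral is d times the convolution of e^(- b x) W x
    with e^(- (b - d) x), so F has Laplace transform
      (1 + d / (u + b - d)) / psi (u + b) = (u + b) / ((u + b - d) psi (u + b))
    for large u ([laplace_tilted_convolution]). This is the inverse of the
    transformed exponent at u, provided that the constant subtracted in that
    exponent vanishes. For b = d it does; for b = theta it is a multiple of
    psi theta, and psi theta = 0 as soon as theta <> 0: there are zeros l of
    psi tending to theta from below, and E[e^(l X_1); 1 < zeta] = e^(psi l)
    passes to the limit by dominated convergence ([largest_zero_root]).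

    A scale function V of the transformed exponent and F are thus two
    continuous functions with the same Laplace transform near +oo, and Lerch's
    uniqueness theorem gives V = F ([laplace_inj]). For the latter, let g be
    the difference of two such functions. If the integrals of e^(- u x) g x
    vanish for all large u, so do those of e^(- u x) g x (1 - e^(- v x))^k, by
    induction on k. With t = e^(- c x), the polynomials (1 - t^n)^(2^n) take
    values in [0, 1] and converge to 1 for t < 1/2 and to 0 for t > 1/2; for c
    such that e^(- c a) = 1/2, dominated convergence turns the vanishing
    integrals into that of e^(- u x) g x over ]a, +oo[. As a > 0 is arbitrary
    and g is continuous, g = 0. *)

(** * Polynomials converging to the indicator function of [0, 1/2[ *)

Section Sieve.
Context {R : realType}.
Implicit Types t s : R.

Lemma bernoulli_ineq s (k : nat) : -1 <= s -> 1 + s *+ k <= (1 + s) ^+ k.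
Proof.
move=> s1; elim: k => [|k IHk]; first by rewrite mulr0n addr0 expr0.
rewrite exprS.
have s10 : 0 <= 1 + s by rewrite -lerBlDl sub0r.
apply: le_trans (ler_wpM2l s10 IHk).
rewrite mulrS -mulr_natr.
have : 0 <= k%:R * (s * s) by rewrite mulr_ge0// -expr2 sqr_ge0.
lra.
Qed.

(** By Bernoulli's inequality the sequence is at least 1 - (2 t)^n. *)
Lemma cvg_onemXn_lt_half t : 0 <= t < 2^-1 ->
  (1 - t ^+ n) ^+ (2 ^ n) @[n --> \oo] --> (1 : R).
Proof.
move=> /andP[t0 t2].
have tn n : 0 <= t ^+ n <= 1 by rewrite exprn_ge0//= exprn_ile1//; lra.
apply: (@squeeze_cvgr _ _ _ _ (fun n => 1 - (2 * t) ^+ n) (fun=> 1)).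
- apply: nearW => n; have /andP[n0 n1] := tn n; apply/andP; split.
    have h : -1 <= - t ^+ n by rewrite lerN2.
    apply: le_trans (bernoulli_ineq (2 ^ n) h).
    by rewrite mulNrn -[_ *+ (2 ^ n)]mulr_natl natrX exprMn.
  by rewrite exprn_ile1//; lra.
- rewrite -[X in _ --> X]subr0; apply: cvgB; first exact: cvg_cst.
  by apply: cvg_expr; rewrite ger0_norm; lra.
- exact: cvg_cst.
Qed.

(** With s = t^n and N = 2^n, (1 - s)^N (1 + s)^N <= 1 and
    (1 + s)^N >= N s = (2 t)^n, which tends to +oo. *)
Lemma cvg_onemXn_gt_half t : 2^-1 < t <= 1 ->
  (1 - t ^+ n) ^+ (2 ^ n) @[n --> \oo] --> (0 : R).
Proof.
move=> /andP[t2 t1].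
have t0 : 0 < t by lra.
have tn n : 0 <= t ^+ n <= 1 by rewrite exprn_ge0 ?exprn_ile1// ltW.
apply: (@squeeze_cvgr _ _ _ _ (fun=> 0) (fun n => ((2 * t)^-1) ^+ n)).
- apply: nearW => n; have /andP[n0 n1] := tn n.
  have q0 : 0 <= (1 - t ^+ n) ^+ (2 ^ n) by rewrite exprn_ge0//; lra.
  rewrite q0/= exprVn -[leRHS]mulr1 ler_pdivlMl; last first.
    by rewrite exprn_gt0//; lra.
  have h : -1 <= t ^+ n by lra.
  have := bernoulli_ineq (2 ^ n) h.
  rewrite -[_ *+ (2 ^ n)]mulr_natl natrX -exprMn => {}h.
  have : (1 - t ^+ n) ^+ (2 ^ n) * (1 + t ^+ n) ^+ (2 ^ n) <= 1.
    rewrite -exprMn exprn_ile1//; first by rewrite mulr_ge0; lra.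
    have : 0 <= t ^+ n * t ^+ n by rewrite mulr_ge0.
    lra.
  apply: le_trans; rewrite mulrC ler_wpM2l//; lra.
- exact: cvg_cst.
- apply: cvg_expr; rewrite ger0_norm; last by rewrite invr_ge0; lra.
  by rewrite invf_lt1; lra.
Qed.

End Sieve.

(** * Injectivity of the Laplace transform *)

Lemma continuous_expRM {R : realType} (p : R) :
  continuous (fun x : R => expR (p * x)).
Proof.
move=> x; apply: continuous_comp; last exact: continuous_expR.
by apply: continuousM; [exact: cst_continuous|exact: cvg_id].
Qed.

Section Uniqueness.
Context {R : realType}.
Notation mu := (@lebesgue_measure R).
Variables (g : R -> R) (u0 : R).
Hypothesis g_int : forall u, u0 < u ->
  mu.-integrable `[0%R, +oo[ (EFin \o (fun x => expR (- u * x) * g x)).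
Hypothesis g_laplace0 : forall u, u0 < u ->
  (\int[mu]_(x in `[0%R, +oo[) (expR (- u * x) * g x)%:E = 0)%E.

(** The vanishing for all u > u0 is stable under multiplication by
    1 - e^(- v x): the product is a difference of transforms at u and u + v. *)
Lemma laplace0_onem_expR (k : nat) (u v : R) : u0 < u -> 0 <= v ->
  mu.-integrable `[0%R, +oo[
    (EFin \o (fun x => expR (- u * x) * g x * (1 - expR (- v * x)) ^+ k)) /\
  (\int[mu]_(x in `[0%R, +oo[)
    (expR (- u * x) * g x * (1 - expR (- v * x)) ^+ k)%:E = 0)%E.
Proof.
move=> + v0; elim: k u => [|k IHk] u u0u.
  have E : (fun x => expR (- u * x) * g x * (1 - expR (- v * x)) ^+ 0) =
           (fun x => expR (- u * x) * g x).
    by apply/funext => x; rewrite expr0 mulr1.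
  split; first by rewrite E; exact: g_int.
  by under eq_integral do rewrite expr0 mulr1; exact: g_laplace0.
have [i1 e1] := IHk _ u0u.
have u0uv : u0 < u + v by rewrite ltr_wpDr.
have [i2 e2] := IHk _ u0uv.
have E x : expR (- u * x) * g x * (1 - expR (- v * x)) ^+ k.+1 =
    expR (- u * x) * g x * (1 - expR (- v * x)) ^+ k -
    expR (- (u + v) * x) * g x * (1 - expR (- v * x)) ^+ k.
  by rewrite opprD mulrDl expRD exprS; ring.
split.
  have -> : (EFin \o (fun x =>
      expR (- u * x) * g x * (1 - expR (- v * x)) ^+ k.+1)) =
    ((EFin \o (fun x => expR (- u * x) * g x * (1 - expR (- v * x)) ^+ k)%R) \-
    (EFin \o (fun x =>
      expR (- (u + v) * x) * g x * (1 - expR (- v * x)) ^+ k)%R))%E.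
    by apply/funext => x /=; rewrite E.
  exact: integrableB.
under eq_integral do rewrite E EFinB.
by rewrite integralB_EFin// e1 e2 sube0.
Qed.

(** The limit in n of the previous lemma with v = c n and k = 2^n. *)
Lemma laplace0_tail (a u : R) : 0 < a -> u0 < u ->
  (\int[mu]_(x in `]a, +oo[) (expR (- u * x) * g x)%:E = 0)%E.
Proof.
move=> a0 u0u.
(* With this c, e^(- c x) crosses the threshold 1/2 exactly at x = a. *)
pose c : R := ln 2 / a.
have c0 : 0 < c by rewrite divr_gt0// ln_gt0// ltr1n.
have ea : expR (- c * a) = 2^-1.
  by rewrite mulNr mulfVK ?gt_eqF// expRN lnK// posrE.
pose h x : R := expR (- u * x) * g x.
pose h_ (n : nat) x : R := h x * (1 - expR (- (c * n%:R) * x)) ^+ (2 ^ n).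
have cn0 n : 0 <= c * n%:R by rewrite mulr_ge0// ltW.
have h_n n := laplace0_onem_expR (2 ^ n) u0u (cn0 n).
have expn n x : expR (- (c * n%:R) * x) = expR (- c * x) ^+ n.
  by rewrite -expRM_natl; congr expR; ring.
have mD : measurable (`[0%R, +oo[ : set R) by exact: measurable_itv.
have hi := g_int u0u.
have := @dominated_convergence _ _ R mu `[0%R, +oo[ mD
  (fun n => EFin \o h_ n) (EFin \o (h \_ `]a, +oo[))
  (abse \o (EFin \o h)).
case=> [n|||||_ _].
- by have [/(measurable_int mu)] := h_n n.
- apply/measurable_EFinP.
  apply: (measurable_restrict h (measurable_itv `]a, +oo[) mD).1.
  have mh : measurable_fun (`[0%R, +oo[ : set R) h.
    by have := measurable_int mu hi => /measurable_EFinP.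
  by apply: (measurable_funS _ _ mh).
(* At x = a the factor (1 - t^n)^(2^n) tends to 1/e: convergence to the
   indicator function holds only almost everywhere. *)
- exists [set a]; split; [exact: measurable_set1|exact: lebesgue_measure_set1|].
  move=> x /=; apply: contra_notP => /eqP xa; rewrite in_itv/= andbT => x0.
  suff H : h_ n x @[n --> \oo] --> (h \_ `]a, +oo[) x.
    by apply: cvg_EFin => //; exact: nearW.
  have -> : h_ ^~ x = fun n => h x * (1 - expR (- c * x) ^+ n) ^+ (2 ^ n).
    by apply/funext => n; rewrite /h_ expn.
  rewrite /patch.
  have ex0 := expR_gt0 (- c * x).
  case: ifPn; rewrite ?notin_setE ?inE/= in_itv/= andbT.
    move=> ax; rewrite -[X in _ --> X]mulr1.
    apply: cvgM; first exact: cvg_cst.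
    by apply: cvg_onemXn_lt_half; rewrite ltW//= -ea ltr_expR !mulNr ltrN2 ltr_pM2l.
  move=> /negP; rewrite -leNgt le_eqVlt (negbTE xa)/= => {}xa.
  rewrite -[X in _ --> X](mulr0 (h x)).
  apply: cvgM; first exact: cvg_cst.
  apply: cvg_onemXn_gt_half; rewrite -{1}ea ltr_expR !mulNr ltrN2 ltr_pM2l// xa/=.
  by rewrite -expR0 ler_expR oppr_le0 mulr_ge0// ltW.
- exact: integrable_abse.
- apply/aeW => x n; rewrite /= in_itv/= andbT => x0.
  rewrite lee_fin /h_ normrM ler_piMr// normrX expn.
  have e1 : expR (- c * x) ^+ n <= 1.
    rewrite exprn_ile1 ?expR_ge0// -expR0 ler_expR mulNr oppr_le0.
    by rewrite mulr_ge0// ltW.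
  have e0 : 0 <= expR (- c * x) ^+ n by rewrite exprn_ge0 ?expR_ge0.
  by rewrite exprn_ile1// ger0_norm; lra.
have -> : [sequence (\int[mu]_(x in `[0%R, +oo[) (EFin \o h_ n) x)%E]_n =
    (fun=> 0%E).
  by apply/funext => n /=; have [] := h_n n.
move=> /(cvg_unique (@ereal_hausdorff R))/(_ (cvg_cst _)).
rewrite -restrict_EFin -integral_mkcondr => E.
rewrite -[RHS]E; congr (integral mu _ _); apply/seteqP; split => x/=.
  by rewrite !in_itv/= !andbT => ax; split => //; exact/ltW/(lt_trans a0).
by case.
Qed.

Lemma laplace0_itv (a b u : R) : 0 < a -> a <= b -> u0 < u ->
  \int[mu]_(x in `]a, b]) (expR (- u * x) * g x) = 0.
Proof.
move=> a0 ab u0u.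
have b0 : 0 < b by exact: lt_le_trans ab.
have hi := g_int u0u.
have tail c : 0 < c ->
    \int[mu]_(x in `]c, +oo[) (expR (- u * x) * g x) = 0.
  by move=> c0; rewrite /Rintegral laplace0_tail.
have sub : (`]a, +oo[ : set R) `<=` `[0%R, +oo[.
  by move=> x /=; rewrite !in_itv/= !andbT => /(lt_trans a0)/ltW.
have U : `]a, +oo[%classic = `]a, b] `|` `]b, +oo[ :> set R.
  by rewrite -itv_bndbnd_setU// bnd_simp.
have := tail _ a0; rewrite U Rintegral_setU//.
- by rewrite tail// addr0.
- by rewrite -U; apply: integrableS hi.
- apply/disj_setPS => y [/=]; rewrite 2!in_itv/= => /andP[_ yb].
  by rewrite andbT ltNge yb.
Qed.

(** If g x were positive, e^(- u y) g y would stay above a positive constant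
    on some ]x, x + d / 2], where its integral is 0. *)
Lemma laplace0_le0 (x : R) : 0 < x -> g y @[y --> x^'+] --> g x -> g x <= 0.
Proof.
move=> x0 gx; rewrite leNgt; apply/negP => gx0.
pose u := u0 + 1; have u0u : u0 < u by rewrite ltrDl.
pose h y : R := expR (- u * y) * g y.
pose e := h x / 2.
have hx0 : 0 < h x by rewrite mulr_gt0// expR_gt0.
have ehx : e < h x by rewrite /e; lra.
have hc : h y @[y --> x^'+] --> h x.
  apply: cvgM gx; apply: cvg_at_right_filter.
  exact: continuous_expRM.
have := cvgr_gt _ hc _ ehx; rewrite near_withinE => -[d /= d0 xd].
have xb : x < x + d / 2 by rewrite ltrDl divr_gt0.
have hi := g_int u0u.
have sub : (`]x, x + d / 2] : set R) `<=` `[0%R, +oo[.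
  move=> y /=; rewrite !in_itv/= andbT => /andP[xy _].
  exact/ltW/(lt_trans x0).
have hI : mu.-integrable `]x, x + d / 2] (EFin \o h) by apply: integrableS hi.
have muI : mu `]x, x + d / 2] = (d / 2)%:E.
  by rewrite lebesgue_measure_itv/= lte_fin xb -EFinD addrAC subrr add0r.
suff : e * (d / 2) <= 0 by rewrite leNgt mulr_gt0// divr_gt0.
have <- := laplace0_itv x0 (ltW xb) u0u.
have -> : e * (d / 2) = \int[mu]_(y in `]x, x + d / 2]) e.
  by rewrite Rintegral_cst//= [X in fine X]muI.
apply: le_Rintegral => //.
- apply/integrableP; split; first exact/measurable_EFinP/measurable_cst.
  rewrite /= [ltLHS](integral_cst mu (measurable_itv _) `|e|%:E).
  by rewrite [X in (_ * X)%E]muI -EFinM ltry.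
- move=> y /=; rewrite in_itv/= => /andP[xy yd]; apply/ltW/xd => //.
  by rewrite /ball/= ltr0_norm ?subr_lt0//; lra.
Qed.

End Uniqueness.

Section LaplaceInjectivity.
Context {R : realType}.
Notation mu := (@lebesgue_measure R).

Let laplace_le (f g : R -> R) (u0 x : R) :
  {within `[0, +oo[, continuous f} -> {within `[0, +oo[, continuous g} ->
  (forall u, u0 < u ->
     mu.-integrable `[0%R, +oo[ (EFin \o (fun y => expR (- u * y) * f y))) ->
  (forall u, u0 < u ->
     mu.-integrable `[0%R, +oo[ (EFin \o (fun y => expR (- u * y) * g y))) ->
  (forall u, u0 < u ->
     (\int[mu]_(y in `[0%R, +oo[) (expR (- u * y) * f y)%:E =
      \int[mu]_(y in `[0%R, +oo[) (expR (- u * y) * g y)%:E)%E) ->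
  0 < x -> f x <= g x.
Proof.
move=> /continuous_within_itvcyP[cf _] /continuous_within_itvcyP[cg _].
move=> fi gi fg x0; rewrite -subr_le0.
have E (u y : R) : expR (- u * y) * (f y - g y) =
    expR (- u * y) * f y - expR (- u * y) * g y by rewrite mulrBr.
apply: (@laplace0_le0 _ (fun y => f y - g y) u0 _ _ _ x0).
- move=> u u0u.
  apply: eq_integrable (integrableB _ (fi _ u0u) (gi _ u0u)) => //.
  by move=> y _ /=; rewrite E.
- move=> u u0u; under eq_integral do rewrite E EFinB.
  rewrite integralB_EFin//; [|exact: fi|exact: gi].
  rewrite fg// subee//; apply: integrable_fin_num => //; exact: gi.
- apply: cvg_at_right_filter; apply: cvgB.
    by apply: cf; rewrite in_itv/= x0.
  by apply: cg; rewrite in_itv/= x0.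
Qed.

(** Lerch's theorem, for continuous functions on the closed half-line. The
    value at 0 follows from the positive ones by right continuity. *)
Lemma laplace_inj (f g : R -> R) (u0 : R) :
  {within `[0, +oo[, continuous f} -> {within `[0, +oo[, continuous g} ->
  (forall u, u0 < u ->
     mu.-integrable `[0%R, +oo[ (EFin \o (fun y => expR (- u * y) * f y))) ->
  (forall u, u0 < u ->
     mu.-integrable `[0%R, +oo[ (EFin \o (fun y => expR (- u * y) * g y))) ->
  (forall u, u0 < u ->
     (\int[mu]_(y in `[0%R, +oo[) (expR (- u * y) * f y)%:E =
      \int[mu]_(y in `[0%R, +oo[) (expR (- u * y) * g y)%:E)%E) ->
  forall x, 0 <= x -> f x = g x.
Proof.
move=> cf cg fi gi fg x.
have pos y : 0 < y -> f y = g y.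
  move=> y0; apply/le_anti; rewrite (laplace_le cf cg fi gi fg y0)/=.
  by apply: (laplace_le cg cf gi fi _ y0) => u u0u; rewrite fg.
rewrite le_eqVlt => /predU1P[<-|]; last exact: pos.
move: cf cg => /continuous_within_itvcyP[_ f0] /continuous_within_itvcyP[_ g0].
apply: (cvg_unique (@Rhausdorff R) f0).
apply: cvg_trans g0; apply: near_eq_cvg.
by near=> y; rewrite pos.
Unshelve. all: by end_near. Qed.

End LaplaceInjectivity.

(** * Primitives of continuous functions and their Laplace transform *)

Section Primitive.
Context {R : realType}.
Notation mu := (@lebesgue_measure R).
Variable f : R -> R.
Hypothesis cf : {within `[0, +oo[, continuous f}.

Lemma halfline_continuous_integrable (b : R) :
  mu.-integrable `[0%R, b] (EFin \o f).
Proof.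
apply: continuous_compact_integrable; first exact: segment_compact.
by apply: continuous_subspaceW cf; exact: subset_itvl.
Qed.

Lemma halfline_continuous_measurable : measurable_fun (`[0%R, +oo[ : set R) f.
Proof. by apply: subspace_continuous_measurable_fun cf; exact: measurable_itv. Qed.

Lemma continuous_primitive :
  {within `[0, +oo[, continuous (fun x => \int[mu]_(y in `[0, x]) f y)}.
Proof.
have H (b : R) : 0 < b ->
    {within `[0, b], continuous (fun x => \int[mu]_(y in `[0, x]) f y)}.
  move=> b0; apply: parameterized_integral_continuous; first exact: ltW.
  exact: halfline_continuous_integrable.
apply/continuous_within_itvcyP; split.
  move=> x; rewrite in_itv/= andbT => x0.
  have x1 : 0 < x + 1 by rewrite addr_gt0.
  apply: (within_continuous_continuous x1 (H _ x1)).
  by rewrite in_itv/= x0 ltrDl ltr01.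
by have /(continuous_within_itvP _ ltr01)[_ + _] := H _ ltr01.
Qed.

End Primitive.

Section LaplacePrimitive.
Context {R : realType}.
Notation mu := (@lebesgue_measure R).

Lemma integral_expR_tail (p y : R) : 0 < p ->
  (\int[mu]_(x in `[y, +oo[) (expR (- p * x))%:E =
   (p^-1 * expR (- p * y))%:E)%E.
Proof.
move=> p0.
rewrite (@ge0_continuous_FTC2y _ _ (fun x => - p^-1 * expR (- p * x)) _ 0).
- by rewrite sub0e -EFinN mulNr opprK.
- by move=> x _; exact: expR_ge0.
- by apply: continuous_subspaceT; exact: continuous_expRM.
- rewrite -[X in _ --> X](mulr0 (- p^-1)); apply: cvgM; first exact: cvg_cst.
  rewrite (_ : (fun x => expR (- p * x)) =
               (fun z => expR (- z)) \o (fun z => p * z)); last first.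
    by apply: eq_fun => x; rewrite mulNr.
  apply: (@cvg_comp _ _ _ _ _ _ (pinfty_nbhs R)); last exact: cvgr_expR.
  exact: gt0_cvgMry.
- by move=> x _; exact: ex_derive.
- apply/cvg_at_right_filter; apply: cvgM; first exact: cvg_cst.
  exact: continuous_expRM.
- move=> z _; rewrite derive1Ml// derive1_comp// derive1E.
  have /funeqP -> := @derive_expR R.
  rewrite derive1Ml// derive1_id; field; exact: lt0r_neq0.
Qed.

(** Tonelli's theorem on the cone 0 <= y <= x, the inner integral over x >= y
    being e^(- p y) / p. *)
Lemma laplace_primitive (f : R -> R) (p : R) :
  {within `[0, +oo[, continuous f} -> (forall x, 0 <= x -> 0 <= f x) -> 0 < p ->
  (\int[mu]_(x in `[0%R, +oo[)
     (expR (- p * x) * \int[mu]_(y in `[0%R, x]) f y)%:E =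
   (p^-1)%:E * \int[mu]_(y in `[0%R, +oo[) (expR (- p * y) * f y)%:E)%E.
Proof.
move=> cf f0 p0.
have mD : measurable (`[0%R, +oo[ : set R) by exact: measurable_itv.
pose D := `[0%R, +oo[%classic : set R.
have DE y : (y \in D) = (0 <= y) by rewrite mem_setE in_itv/= andbT.
pose k (z : R * R) : \bar R :=
  (expR (- p * z.1) * (f \_ D) z.2 * (z.2 <= z.1)%R%:R)%:E.
have mf : measurable_fun setT (f \_ D).
  apply/(measurable_restrictT _ mD).
  exact: halfline_continuous_measurable.
have ft0 y : 0 <= (f \_ D) y.
  by rewrite /patch DE; case: ifPn => // /f0.
have mk : measurable_fun setT k.
  apply/measurable_EFinP; apply: measurable_funM.
    apply: measurable_funM.
      apply: measurableT_comp => //; apply: measurable_funM => //.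
    exact: measurableT_comp.
  rewrite (_ : (fun _ => _) = \1_[set z : R * R | z.2 <= z.1]); last first.
    by apply/funext => z; rewrite indicE; congr (_%:R); rewrite mem_setE.
  apply: measurable_indic; rewrite -[X in measurable X]setTI.
  exact: measurable_fun_le.
have k0 z : (0 <= k z)%E.
  by rewrite lee_fin; apply: mulr_ge0 => //; rewrite mulr_ge0// expR_ge0.
transitivity (\int[mu]_x \int[mu]_y k (x, y))%E.
  rewrite integral_mkcond; apply: eq_integral => x _.
  rewrite {1}/patch DE; case: ifPn.
    move=> x0.
    have fi := halfline_continuous_integrable cf x.
    rewrite EFinM fineK; last exact: integrable_fin_num.
    rewrite -ge0_integralZl_EFin//; last 2 first.
    - by move=> y /=; rewrite in_itv/= lee_fin => /andP[/f0].
    - exact: (measurable_int mu fi).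
    rewrite integral_mkcond; apply: eq_integral => y _.
    rewrite /k /patch/= DE mem_setE in_itv/=.
    case: (leP 0 y) => y0/=; last by rewrite mulr0 mul0r.
    by case: (leP y x) => yx/=; rewrite ?mulr1 ?mulr0.
  rewrite -ltNge => x0.
  rewrite integral0_eq// => y _.
  rewrite /k /patch/= DE.
  case: (leP 0 y) => y0; last by rewrite mulr0 mul0r.
  by rewrite leNgt (lt_le_trans x0 y0)/= mulr0.
rewrite (@fubini_tonelli _ _ _ _ R mu mu k mk k0).
have mexp : measurable_fun setT (fun x : R => expR (- p * x)).
  by apply: measurableT_comp => //; exact: measurable_funM.
rewrite -ge0_integralZl_EFin//; last 3 first.
- move=> y; rewrite /= in_itv/= andbT lee_fin => /f0 fy.
  by rewrite mulr_ge0 ?expR_ge0.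
- apply/measurable_EFinP; apply: measurable_funM; first exact: measurable_funTS.
  exact: halfline_continuous_measurable.
- by rewrite invr_ge0 ltW.
rewrite [in RHS]integral_mkcond; apply: eq_integral => y _.
rewrite [in RHS]/patch DE; case: ifPn; last first.
  move=> y0; rewrite integral0_eq// => x _.
  by rewrite /k /patch/= DE (negbTE y0) mulr0 mul0r.
move=> y0.
transitivity (\int[mu]_(x in `[y, +oo[) ((f y)%:E * (expR (- p * x))%:E))%E.
  rewrite [in RHS]integral_mkcond; apply: eq_integral => x _.
  rewrite /k /patch/= DE y0 mem_setE in_itv/= andbT.
  by case: (leP y x) => yx/=; rewrite ?mulr1 ?mulr0// mulrC EFinM.
rewrite ge0_integralZl_EFin//; last 2 first.
- by apply/measurable_EFinP; exact: measurable_funTS.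
- exact: f0.
by rewrite integral_expR_tail// -!EFinM; congr EFin; ring.
Qed.

End LaplacePrimitive.

(** * Scale functions through their Laplace transforms *)

Section ScaleTransform.
Context {R : realType}.
Notation mu := (@lebesgue_measure R).
Implicit Types (psi T W V : R -> R).

Let expRM_within (p : R) :
  {within `[0, +oo[, continuous (fun x : R => expR (p * x))}.
Proof. by apply: continuous_subspaceT; exact: continuous_expRM. Qed.

Let within_continuousM (f g : R -> R) :
  {within `[0, +oo[, continuous f} -> {within `[0, +oo[, continuous g} ->
  {within `[0, +oo[, continuous (fun x => f x * g x)}.
Proof.
move=> /continuous_within_itvcyP[cf f0] /continuous_within_itvcyP[cg g0].
apply/continuous_within_itvcyP; split; last exact: cvgM.
by move=> x x0; apply: continuousM; [exact: cf|exact: cg].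
Qed.

Let within_continuousD (f g : R -> R) :
  {within `[0, +oo[, continuous f} -> {within `[0, +oo[, continuous g} ->
  {within `[0, +oo[, continuous (fun x => f x + g x)}.
Proof.
move=> /continuous_within_itvcyP[cf f0] /continuous_within_itvcyP[cg g0].
apply/continuous_within_itvcyP; split; last exact: cvgD.
by move=> x x0; apply: continuousD; [exact: cf|exact: cg].
Qed.

Lemma laplace_integrable (f : R -> R) (u c : R) :
  {within `[0, +oo[, continuous f} -> (forall x, 0 <= x -> 0 <= f x) ->
  (\int[mu]_(x in `[0%R, +oo[) (expR (- u * x) * f x)%:E = c%:E)%E ->
  mu.-integrable `[0%R, +oo[ (EFin \o (fun x => expR (- u * x) * f x)).
Proof.
move=> cf f0 fc; apply/integrableP; split.
  apply/measurable_EFinP.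
  by apply: halfline_continuous_measurable; apply: within_continuousM.
under eq_integral => x.
  rewrite inE/= in_itv/= andbT => x0.
  rewrite ger0_norm ?mulr_ge0 ?f0 ?expR_ge0//.
  over.
by rewrite fc ltry.
Qed.

(** The convolution on the half-line of e^(- b x) W x with the measure
    (Dirac mass at 0) + d e^(- (b - d) x) dx. *)
Definition tilted_convolution (b d : R) W (x : R) : R :=
  expR (- b * x) *
  (W x + d * expR (d * x) * \int[mu]_(y in `[0, x]) (expR (- d * y) * W y)).

Section tilted.
Variables (b d : R) (W : R -> R).
Hypotheses (cW : {within `[0, +oo[, continuous W})
  (W0 : forall x, 0 <= x -> 0 <= W x) (d0 : 0 <= d).

Let G x := \int[mu]_(y in `[0, x]) (expR (- d * y) * W y).

Let cG : {within `[0, +oo[, continuous G}.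
Proof. by apply: continuous_primitive; exact: within_continuousM. Qed.

Let G0 x : 0 <= G x.
Proof.
apply: Rintegral_ge0 => y /=; rewrite in_itv/= => /andP[y0 _].
by rewrite mulr_ge0 ?expR_ge0 ?W0.
Qed.

Lemma tilted_convolution_continuous :
  {within `[0, +oo[, continuous (tilted_convolution b d W)}.
Proof.
apply: within_continuousM => //; apply: within_continuousD => //.
apply: within_continuousM => //; apply: within_continuousM => //.
by apply: continuous_subspaceT => x; exact: cst_continuous.
Qed.

Lemma tilted_convolution_ge0 x : 0 <= x -> 0 <= tilted_convolution b d W x.
Proof.
move=> x0; rewrite mulr_ge0 ?expR_ge0// addr_ge0 ?W0//.
by rewrite mulr_ge0 ?G0// mulr_ge0 ?expR_ge0.
Qed.

(** With G the primitive of e^(- d y) W y, the integrand is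
    e^(- (u + b) x) W x + d e^(- (u + b - d) x) G x, and the transform of G at
    p = u + b - d is that of W at p + d = u + b, divided by p. *)
Lemma laplace_tilted_convolution (u c : R) : d < u + b ->
  (\int[mu]_(x in `[0%R, +oo[) (expR (- (u + b) * x) * W x)%:E = c%:E)%E ->
  (\int[mu]_(x in `[0%R, +oo[)
     (expR (- u * x) * tilted_convolution b d W x)%:E =
   ((u + b) / (u + b - d) * c)%:E)%E.
Proof.
move=> dub Wc.
have p0 : 0 < u + b - d by rewrite subr_gt0.
have mD : measurable (`[0%R, +oo[ : set R) by exact: measurable_itv.
have E x : expR (- u * x) * tilted_convolution b d W x =
    expR (- (u + b) * x) * W x + d * (expR (- (u + b - d) * x) * G x).
  rewrite /tilted_convolution -/(G x).
  have -> : - (u + b) * x = - u * x + - b * x by ring.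
  have -> : - (u + b - d) * x = - u * x + (- b * x + d * x) by ring.
  by rewrite !expRD; ring.
under eq_integral do rewrite E EFinD (EFinM d).
have ci : forall (r : R) (f : R -> R), {within `[0, +oo[, continuous f} ->
    measurable_fun (`[0%R, +oo[ : set R) (fun x => (expR (- r * x) * f x)%:E).
  move=> r f cf; apply/measurable_EFinP; apply: halfline_continuous_measurable.
  exact: within_continuousM.
have nn : forall (r : R) (f : R -> R), (forall x, 0 <= x -> 0 <= f x) ->
    forall x, (`[0%R, +oo[%classic : set R) x ->
    (0 <= (expR (- r * x) * f x)%:E)%E.
  move=> r f f0 x /=; rewrite in_itv/= andbT => /f0 fx.
  by rewrite lee_fin mulr_ge0 ?expR_ge0.
rewrite ge0_integralD//; last 4 first.
- exact: nn.
- exact: ci.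
- move=> x xD; apply: mule_ge0; first by rewrite lee_fin.
  exact: nn xD.
- by apply: emeasurable_funM => //; exact: ci.
rewrite Wc ge0_integralZl_EFin//; last 2 first.
- by apply: nn.
- exact: ci.
rewrite laplace_primitive//; last 2 first.
- exact: within_continuousM.
- by move=> x x0; rewrite mulr_ge0 ?expR_ge0 ?W0.
under eq_integral do rewrite mulrA -expRD.
rewrite (_ : (\int[mu]_(x in _) _)%E = c%:E); last first.
  rewrite -Wc; apply: eq_integral => x _.
  by congr (expR _ * _)%:E; ring.
rewrite -!EFinM -EFinD; congr EFin; field.
by rewrite gt_eqF.
Qed.

End tilted.

(** Both functions have Laplace transform 1 / T u for u large: above the
    largest zeros of psi and T so that the transforms of W and V are known,
    above d for the convolution, and above 0 for the expression of T. *)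
Lemma scale_function_transform psi T W V (b d x : R) :
  0 <= b -> 0 <= d ->
  is_scale_function psi W -> is_scale_function T V ->
  (forall u, 0 < u -> T u = (u + b - d) / (u + b) * psi (u + b)) ->
  0 <= x -> V x = tilted_convolution b d W x.
Proof.
move=> b0 d0 [cW W0 _ _ LW] [cV V0 _ _ LV] TE.
pose u0 := Num.max (Num.max 0 d) (Num.max (largest_zero psi) (largest_zero T)).
have LF u : u0 < u -> (\int[mu]_(y in `[0%R, +oo[)
    (expR (- u * y) * tilted_convolution b d W y)%:E = ((T u)^-1)%:E)%E.
  rewrite !gt_max => /andP[/andP[u_0 ud] /andP[uz uT]].
  have ub v : v < u -> v < u + b by move=> vu; rewrite ltr_wpDr.
  rewrite (laplace_tilted_convolution cW W0 d0 (ub _ ud) (LW _ (ub _ uz))).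
  by rewrite TE// !invfM invrK [(u + b) / _]mulrC.
have {}LV u : u0 < u -> (\int[mu]_(y in `[0%R, +oo[)
    (expR (- u * y) * V y)%:E = ((T u)^-1)%:E)%E.
  by rewrite !gt_max => /andP[_ /andP[_ uT]]; exact: LV.
have cF := @tilted_convolution_continuous b d _ cW.
apply: (laplace_inj cV cF (u0 := u0)) => u u0u.
- exact: laplace_integrable (LV _ u0u).
- apply: laplace_integrable (LF _ u0u) => //.
  exact: tilted_convolution_ge0.
- by rewrite LV// LF.
Qed.

End ScaleTransform.

(** * The largest zero of the Laplace exponent is a zero *)

Section LargestZero.
Context {R : realType} {d : measure_display} {T : measurableType d}.
Variables (P : probability T R) (X : R -> T -> R) (kappa : R)
  (zeta : T -> \bar R) (psi : R -> R).
Hypotheses (hX : levy_process P X)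
  (hzeta : independent_killing_time P X kappa zeta)
  (hpsi : is_laplace_exponent P X zeta psi).

Lemma largest_zero_ge0 (phi : R -> R) : 0 <= largest_zero phi.
Proof.
rewrite /largest_zero; set E := [set _ | _].
have [[[l El] ubE]|/sup_out -> //] := pselect (has_sup E).
by apply: (@le_trans _ _ l); [case: El|apply: ub_le_sup].
Qed.

(** Left continuity of u |-> E[e^(u X_1); 1 < zeta] by dominated convergence:
    e^(l x) <= 1 + e^(theta x) for 0 <= l <= theta and every real x. *)
Lemma laplace_exponent_left_limit0 (theta : R) (l : R^nat) :
  (forall n, 0 <= l n <= theta) -> (forall n, psi (l n) = 0) ->
  l n @[n --> \oo] --> theta -> psi theta = 0.
Proof.
move=> lt l0 lc.
have t0 : 0 <= theta by have /andP[/le_trans] := lt 0%N; exact.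
pose D := [set w | (1%:E < zeta w)%E].
have mD : measurable D.
  have [mz _ _] := hzeta; rewrite -[D]setTI.
  exact: emeasurable_fun_o_infty.
have mX : measurable_fun D (X 1).
  by apply: measurable_funTS; exact: levy_measurable hX _ ler01.
have mE (u : R) : measurable_fun D (fun w => (expR (u * X 1 w))%:E).
  apply/measurable_EFinP; apply: measurableT_comp => //.
  exact: measurable_funM.
have M (u : R) : 0 <= u ->
    (\int[P]_(w in D) (expR (u * X 1 w))%:E = (expR (psi u))%:E)%E.
  by move=> u0; rewrite hpsi// mulr1.
have intM : P.-integrable D (fun w => (1 + expR (theta * X 1 w))%:E).
  apply: (@integrableD _ _ _ _ _ mD (cst 1%E) (fun w => (expR (theta * X 1 w))%:E)).
    apply/integrableP; split; first exact: measurable_cst.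
    rewrite [ltLHS](integral_cst P mD `|1|%E) abse1 mul1e.
    by apply: le_lt_trans (probability_le1 P mD) _; rewrite ltry.
  apply/integrableP; split => //.
  under eq_integral do rewrite gee0_abs ?lee_fin ?expR_ge0//.
  by rewrite M// ltry.
have : (\int[P]_(w in D) (expR (l n * X 1 w))%:E)%E @[n --> \oo] -->
    (\int[P]_(w in D) (expR (theta * X 1 w))%:E)%E.
  apply: (@dominated_cvg _ _ R P D mD _ _
    (fun w => (1 + expR (theta * X 1 w))%:E)) => // [w _|n w _].
  - apply: cvg_EFin; first exact: nearW.
    apply: continuous_cvg; first exact: continuous_expR.
    by apply: cvgM => //; exact: cvg_cst.
  - have /andP[ln lnt] := lt n.
    rewrite lee_fin ger0_norm ?expR_ge0//.
    have [Xw|Xw] := leP 0 (X 1 w).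
      apply: (@le_trans _ _ (expR (theta * X 1 w))); last by rewrite lerDr.
      by rewrite ler_expR ler_wpM2r.
    apply: (@le_trans _ _ 1); last by rewrite lerDl expR_ge0.
    by rewrite -[leRHS]expR0 ler_expR mulr_ge0_le0// ltW.
have -> : (fun n => \int[P]_(w in D) (expR (l n * X 1 w))%:E)%E = fun=> 1%E.
  by apply/funext => n; have /andP[ln _] := lt n; rewrite M// l0 expR0.
rewrite M//.
move=> /(cvg_unique (@ereal_hausdorff R))/(_ (cvg_cst _)) [].
by rewrite -expR0 => /expR_inj.
Qed.

(** If the set of zeros is empty or unbounded, its supremum is 0 by
    convention, so a nonzero value is a true supremum, hence a limit of zeros
    from the left. *)
Lemma largest_zero_root : largest_zero psi != 0 -> psi (largest_zero psi) = 0.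
Proof.
set theta := largest_zero psi => z0.
pose E := [set l | 0 <= l /\ psi l = 0].
have hE : has_sup E.
  by apply: contrapT => /sup_out z; move: z0; rewrite /theta /largest_zero z eqxx.
have /choice[l lP] (n : nat) : exists l, E l /\ theta - n.+1%:R^-1 < l.
  have n0 : (0 : R) < n.+1%:R^-1 by rewrite invr_gt0.
  by have [l El nl] := sup_adherent n0 hE; exists l.
have lub n : l n <= theta.
  by have [El _] := lP n; apply: ub_le_sup => //; case: hE.
apply: (@laplace_exponent_left_limit0 theta l).
- by move=> n; rewrite lub andbT; have [[]] := lP n.
- by move=> n; have [[]] := lP n.
- apply: (@squeeze_cvgr _ _ _ _ (fun n => theta - n.+1%:R^-1) (fun=> theta)).
  + by apply: nearW => n; rewrite lub andbT; have [_ /ltW] := lP n.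
  + rewrite -[X in _ --> X]subr0; apply: cvgB; first exact: cvg_cst.
    exact: cvg_harmonic.
  + exact: cvg_cst.
Qed.

End LargestZero.


(** * Scale functions of the transformed exponents *)

Theorem theorem3p1 (R : realType) (d : measure_display) (T : measurableType d)
    (P : probability T R) (X : R -> T -> R) (kappa : R) (zeta : T -> \bar R)
    (psi W : R -> R) (theta : R)
    (hX : levy_process P X) (hneg : no_positive_jumps P X)
    (hmon : ~ monotone_paths P X)
    (hkappa : 0 <= kappa) (hzeta : independent_killing_time P X kappa zeta)
    (hpsi : is_laplace_exponent P X zeta psi)
    (htheta : theta = largest_zero psi)
    (hW : is_scale_function psi W) :
  (forall (x beta : R) (V : R -> R), 0 <= x -> 0 <= beta ->
     is_scale_function (exponent_transform1 beta psi) V ->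
     V x = expR (- beta * x) * W x +
           beta * \int[lebesgue_measure]_(y in `[0, x])
                    (expR (- beta * y) * W y))
  /\
  ((right_derivative0 psi <= 0)%E ->
   forall (x delta : R) (V : R -> R), 0 <= x -> 0 <= delta ->
     is_scale_function (exponent_transform delta theta psi) V ->
     V x = expR (- theta * x) *
           (W x + delta * expR (delta * x) *
                  \int[lebesgue_measure]_(y in `[0, x])
                    (expR (- delta * y) * W y))).
Proof.
split=> [x beta V x0 beta0 hV|_ x delta V x0 delta0 hV].
  rewrite (scale_function_transform beta0 beta0 hW hV _ x0).
    rewrite /tilted_convolution mulrDr; congr +%R.
    rewrite !mulrA [expR _ * beta]mulrC -[beta * _ * _]mulrA -expRD.
    by rewrite mulNr addNr expR0 mulr1.
  move=> u u0; have ub : u + beta != 0 by rewrite gt_eqF// ltr_wpDr.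
  rewrite /exponent_transform1 /exponent_transform (negbTE ub).
  by rewrite subrr !mul0r if_same subr0.
have theta0 : 0 <= theta by rewrite htheta largest_zero_ge0.
rewrite (scale_function_transform theta0 delta0 hW hV _ x0)//.
move=> u u0; have ub : u + theta != 0 by rewrite gt_eqF// ltr_wpDr.
rewrite /exponent_transform (negbTE ub); case: ifPn => [_|t0].
  by rewrite subr0.
have -> : psi theta = 0.
  by rewrite htheta; apply: (largest_zero_root hX hzeta hpsi); rewrite -htheta.
by rewrite mulr0 subr0.
Qed.
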